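(* Let $n\ge 5$ and let $A_1,\dots,A_n$ be $n$ points in the (Euclidean) plane, no three on a line, with indices considered modulo $n$. For each $i$ put $l_i=\langle A_{i-1},A_{i+1}\rangle$, and assume that for every $i$ the lines $l_i=\langle A_{i-1},A_{i+1}\rangle$ and $l_{i+1}=\langle A_i,A_{i+2}\rangle$ intersect in a point $B_{i,i+1}$. Let $c_{i,i+1}$ be the circle through $A_i$, $B_{i,i+1}$ and $A_{i+1}$, and let $g_i$ be the radical axis of the circles $c_{i-1,i}$ and $c_{i,i+1}$. If the lines $g_1,g_2,\dots,g_{n-3}$ lie in a pencil, then the remaining three radical axes $g_{n-2}$, $g_{n-1}$ and $g_n$ lie in the same pencil (so that all of $g_1,\dots,g_n$ lie in a pencil).
   Context: $\langle X,Y\rangle$ denotes the line through two distinct points $X,Y$. Lines ''lie in a pencil'' if they are concurrent (all pass through one common point) or all parallel. The radical axis of two non-concentric circles is the line of points having equal power with respect to both circles. *)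

(* Defs.v *)
From mathcomp Require Import all_boot all_order all_algebra.
From mathcomp Require Import all_classical all_reals.

Set Implicit Arguments.
Unset Strict Implicit.
Unset Printing Implicit Defensive.

Import Order.TTheory GRing.Theory Num.Theory.

Local Open Scope classical_set_scope.
Local Open Scope ring_scope.

Notation plane R := 'rV[R]_2 (only parsing).

(* Squared Euclidean distance; the norm that MathComp-Analysis puts on 'rV[R]_2
   is the sup norm, hence the explicit sum of squares. *)
Definition sqdist (R : realType) (X Y : plane R) : R :=
  \sum_(j < 2) (X 0 j - Y 0 j) ^+ 2.

(* The line <X, Y>; a genuine line only when X != Y. *)
Definition line_through (R : realType) (X Y : plane R) : set (plane R) :=
  [set Z | exists t : R, Z = X + t *: (Y - X)].

Definition is_line (R : realType) (L : set (plane R)) : Prop :=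
  exists X Y : plane R, X != Y /\ L = line_through X Y.

(* Coincident points count as collinear, so "no three of the A_i on a line"
   also forces the A_i to be pairwise distinct. *)
Definition collinear (R : realType) (X Y Z : plane R) : Prop :=
  exists L : set (plane R), [/\ is_line L, L X, L Y & L Z].

Definition parallel (R : realType) (L M : set (plane R)) : Prop :=
  L = M \/ L `&` M = set0.

Record circle (R : realType) := Circle {
  center : plane R;
  radius : R;
  radius_gt0 : 0 < radius
}.

Definition on_circle (R : realType) (c : circle R) (X : plane R) : Prop :=
  sqdist X (center c) = radius c ^+ 2.

Definition power (R : realType) (c : circle R) (X : plane R) : R :=
  sqdist X (center c) - radius c ^+ 2.

(* This is a line exactly when the two circles are not concentric. *)
Definition radical_axis (R : realType) (c d : circle R) : set (plane R) :=
  [set X | power c X = power d X].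

(* Either all the lines through a point, or all the lines parallel to a given
   line. *)
Definition is_pencil (R : realType) (P : set (set (plane R))) : Prop :=
  (exists O : plane R, P = [set L | is_line L /\ L O]) \/
  (exists M : set (plane R), is_line M /\ P = [set L | is_line L /\ parallel L M]).

(* Indices modulo n are the elements of 'I_n with the cyclic successor ordS and
   predecessor ord_pred. *)
Definition short_diagonal (R : realType) n (A : 'I_n -> plane R) (i : 'I_n)
    : set (plane R) :=
  line_through (A (ord_pred i)) (A (ordS i)).

(* c i stands for c_{i,i+1}. *)
Definition consecutive_radical_axis (R : realType) n (c : 'I_n -> circle R)
    (i : 'I_n) : set (plane R) :=
  radical_axis (c (ord_pred i)) (c i).

(* Main.v *)
(* A conic Q for which every A_i is the pole of l_i makes the triangles
   A_i B_i A_{i+1} self-polar, so by Gaskin's theorem all circles c_{i,i+1} are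
   orthogonal to the director circle of Q; in particular its centre (a point at
   infinity when Q is a parabola) has the same power with respect to all of them.
   Five incidences A_i, A_{i+1} conjugate can always be imposed on a conic, and
   then three consecutive circles already determine the director circle, because
   they are not coaxal.  Hence the centre of the given pencil and the common
   power there come from this director circle.  Conversely, if A_{i-1}, A_i and
   A_i, A_{i+1} are conjugate, orthogonality of c_{i,i+1} to the director circle
   forces A_{i+1}, A_{i+2} to be conjugate.  The circles of the first n - 3 axes
   thus propagate conjugacy around the whole polygon, and Gaskin's theorem then
   gives the remaining axes. *)
Require Import Defs.
From mathcomp Require Import all_boot all_order all_algebra.
From mathcomp Require Import all_classical all_reals.
From mathcomp Require Import ring zify.

Set Implicit Arguments.
Unset Strict Implicit.
Unset Printing Implicit Defensive.

Import Order.TTheory GRing.Theory Num.Theory.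

Local Open Scope classical_set_scope.
Local Open Scope ring_scope.

Local Notation "p .x" := (p 0 (0 : 'I_2)) (at level 1, left associativity, format "p .x").
Local Notation "p .y" := (p 0 (1 : 'I_2)) (at level 1, left associativity, format "p .y").

Section Core.
Variable R : realFieldType.
Implicit Types a b c d e f p q r t : 'rV[R]_2.

(** * Affine forms on the plane *)

Lemma ord2P (j : 'I_2) : j = 0 \/ j = 1.
Proof. by case: j => -[|[|//]] lj; [left|right]; apply: val_inj. Qed.

Definition det3 p q r : R :=
  (q.x - p.x) * (r.y - p.y) - (q.y - p.y) * (r.x - p.x).

Lemma affine_form_eq0 (u v w : R) p q r : det3 p q r != 0 ->
  u * p.x + v * p.y + w = 0 -> u * q.x + v * q.y + w = 0 ->
  u * r.x + v * r.y + w = 0 -> [/\ u = 0, v = 0 & w = 0].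
Proof.
rewrite /det3 => D0 hp hq hr.
have u0 : u = 0.
  apply: (mulIf D0); rewrite mul0r.
  transitivity ((u * q.x + v * q.y + w - (u * p.x + v * p.y + w)) * (r.y - p.y)
     - (u * r.x + v * r.y + w - (u * p.x + v * p.y + w)) * (q.y - p.y)); first by ring.
  by rewrite hp hq hr; ring.
have v0 : v = 0.
  apply: (mulIf D0); rewrite mul0r.
  transitivity ((u * r.x + v * r.y + w - (u * p.x + v * p.y + w)) * (q.x - p.x)
     - (u * q.x + v * q.y + w - (u * p.x + v * p.y + w)) * (r.x - p.x)); first by ring.
  by rewrite hp hq hr; ring.
by split=> //; rewrite -hp u0 v0; ring.
Qed.

(** * Conics and conjugate points *)

Record conic := Conic { qxx : R; qxy : R; qyy : R; qxw : R; qyw : R; qww : R }.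
Implicit Types Q : conic.

Definition polar_x Q p := qxx Q * p.x + qxy Q * p.y + qxw Q.
Definition polar_y Q p := qxy Q * p.x + qyy Q * p.y + qyw Q.
Definition polar_w Q p := qxw Q * p.x + qyw Q * p.y + qww Q.
Definition conj_form Q p q := polar_x Q p * q.x + polar_y Q p * q.y + polar_w Q p.

Lemma conj_formC Q p q : conj_form Q p q = conj_form Q q p.
Proof. by rewrite /conj_form /polar_x /polar_y /polar_w; ring. Qed.

(** [p] is a singular point of [Q]: (p : 1) lies in the kernel of its matrix. *)
Definition polar0 Q p := [/\ polar_x Q p = 0, polar_y Q p = 0 & polar_w Q p = 0].

Lemma polar0_3points Q p q r t : det3 q r t != 0 -> conj_form Q p q = 0 ->
  conj_form Q p r = 0 -> conj_form Q p t = 0 -> polar0 Q p.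
Proof. by move=> D0; apply: affine_form_eq0. Qed.

Lemma conj_form_polar0 Q p q : polar0 Q p -> conj_form Q p q = 0.
Proof. by case=> h1 h2 h3; rewrite /conj_form h1 h2 h3; ring. Qed.

Definition conic0 Q :=
  [/\ qxx Q = 0, qxy Q = 0 & qyy Q = 0] /\ [/\ qxw Q = 0, qyw Q = 0 & qww Q = 0].

Lemma conic0_3points Q p q r : det3 p q r != 0 ->
  polar0 Q p -> polar0 Q q -> polar0 Q r -> conic0 Q.
Proof.
move=> D0 [px py pw] [qx qy qw] [rx ry rw].
have [? ? ?] := affine_form_eq0 D0 px qx rx.
have [? ? ?] := affine_form_eq0 D0 py qy ry.
by have [? ? ?] := affine_form_eq0 D0 pw qw rw.
Qed.

Lemma conic_through_5pairs (p q : 'I_5 -> 'rV[R]_2) :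
  exists2 Q, ~ conic0 Q & forall j, conj_form Q (p j) (q j) = 0.
Proof.
(* Column [j] holds [conj_form Q (p j) (q j)] as a linear form in the six entries of [Q]; five
   columns leave a nonzero left kernel. *)
pose M : 'M[R]_(6, 5) := \matrix_(i, j) nth 0
  [:: (p j).x * (q j).x; (p j).x * (q j).y + (p j).y * (q j).x;
      (p j).y * (q j).y; (p j).x + (q j).x; (p j).y + (q j).y; 1] i.
have : kermx M != 0.
  by rewrite kermx_eq0 /row_free neq_ltn ltnS rank_leq_col.
case/rowV0Pn=> v /sub_kermxP vM v0.
pose c k := v 0 (inord k).
exists (Conic (c 0) (c 1) (c 2) (c 3) (c 4) (c 5))%N.
  case=> [] [] /= c0 c1 c2 [] c3 c4 c5; case/eqP: v0.
  apply/rowP=> -[k lk]; rewrite mxE.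
  have -> : Ordinal lk = inord k by apply: val_inj; rewrite /= inordK.
  by move: k lk; do 6?[case=> //].
move=> j; have := congr1 (fun m : 'rV_5 => m 0 j) vM.
rewrite !mxE; do 6! rewrite big_ord_recl; rewrite big_ord0 !mxE /=.
have E (k : nat) (i : 'I_6) : val i = k -> v 0 i = c k.
  by move=> <-; rewrite /c inord_val.
rewrite (E 0)%N // (E 1)%N // (E 2)%N // (E 3)%N // (E 4)%N // (E 5)%N //.
rewrite /conj_form /polar_x /polar_y /polar_w /= => <-; ring.
Qed.


(** * Circles as linear forms and the director circle *)

(* Homogeneous coordinates (s : x : y : w) on the space of circles: a point p is
   (|p|^2 : p : 1), and (s : O : 1) with s = |O|^2 - m is the condition "O has
   power m"; w = 0 is allowed and encodes a direction.  Reading the plane as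
   complex numbers, chord_re and chord_im are the real and imaginary parts of
   the polarization of (z - p) conj (z - q). *)
Definition chord_re p q (s x y w : R) :=
  s - (p.x * x + p.y * y) - (q.x * x + q.y * y) + (p.x * q.x + p.y * q.y) * w.
Definition chord_im p q (x y w : R) :=
  (p.y * q.x - p.x * q.y) * w - (p.y * x - p.x * y) - (q.x * y - q.y * x).

(* The circle through b, c and the intersection of the lines a c and b d has
   equation Im ((z - b) conj (z - c) (c - a) conj (d - b)) = 0. *)
Definition circ_form a b c d (s x y w : R) :=
  chord_re b c s x y w *
    ((c.y - a.y) * (d.x - b.x) - (c.x - a.x) * (d.y - b.y))
  + chord_im b c x y w *
    ((c.x - a.x) * (d.x - b.x) + (c.y - a.y) * (d.y - b.y)).

(* The director circle of Q, from the adjugate of its matrix: (dir_x : dir_y :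
   dir_w) is the pole of the line at infinity. *)
Definition dir_s Q := (qyy Q * qww Q - qyw Q ^+ 2) + (qxx Q * qww Q - qxw Q ^+ 2).
Definition dir_x Q := qxy Q * qyw Q - qxw Q * qyy Q.
Definition dir_y Q := qxy Q * qxw Q - qxx Q * qyw Q.
Definition dir_w Q := qxx Q * qyy Q - qxy Q ^+ 2.

(** For [p = q] the right side is the trace of the quadratic part of the pair of tangents from [p],
    zero when they are perpendicular; the identity polarizes this. *)
Lemma chord_re_director Q p q :
  chord_re p q (dir_s Q) (dir_x Q) (dir_y Q) (dir_w Q) =
  (qxx Q + qyy Q) * conj_form Q p q
  - (polar_x Q p * polar_x Q q + polar_y Q p * polar_y Q q).
Proof.
rewrite /chord_re /conj_form /dir_s /dir_x /dir_y /dir_w.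
rewrite /polar_x /polar_y /polar_w; ring.
Qed.

(** With M the matrix of [Q], this is up to sign the last coordinate of (M p) x (M q) = adj(M) (p x
    q). *)
Lemma chord_im_director Q p q :
  chord_im p q (dir_x Q) (dir_y Q) (dir_w Q) =
  polar_y Q p * polar_x Q q - polar_x Q p * polar_y Q q.
Proof.
rewrite /chord_im /dir_x /dir_y /dir_w.
rewrite /polar_x /polar_y /polar_w; ring.
Qed.

Lemma polar_chord Q p a c : conj_form Q p a = 0 -> conj_form Q p c = 0 ->
  polar_x Q p * (c.x - a.x) + polar_y Q p * (c.y - a.y) = 0.
Proof.
move=> pa pc; transitivity (conj_form Q p c - conj_form Q p a).
  by rewrite /conj_form; ring.
by rewrite pa pc subr0.
Qed.

(** Conjugacy removes the trace term. Reading the normals of the polars of [b], [c] as complex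
    numbers B, C, what remains is - Im (conj(B) (c - a) C conj(d - b)). *)
Lemma circ_form_director Q a b c d : conj_form Q b c = 0 ->
  circ_form a b c d (dir_s Q) (dir_x Q) (dir_y Q) (dir_w Q) =
  - (polar_x Q b * (c.x - a.x) + polar_y Q b * (c.y - a.y)) *
    (polar_y Q c * (d.x - b.x) - polar_x Q c * (d.y - b.y))
  - (polar_x Q b * (c.y - a.y) - polar_y Q b * (c.x - a.x)) *
    (polar_x Q c * (d.x - b.x) + polar_y Q c * (d.y - b.y)).
Proof.
move=> bc; rewrite /circ_form chord_re_director chord_im_director bc; ring.
Qed.

(* Gaskin's theorem for the triangle formed by b, c and the intersection of
   a c and b d. *)
Lemma circ_form_director0 Q a b c d :
  conj_form Q a b = 0 -> conj_form Q b c = 0 -> conj_form Q c d = 0 ->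
  circ_form a b c d (dir_s Q) (dir_x Q) (dir_y Q) (dir_w Q) = 0.
Proof.
move=> ab bc cd; rewrite circ_form_director // polar_chord // 1?conj_formC //.
by rewrite [X in _ - _ * X]polar_chord 1?[conj_form Q c b]conj_formC //; ring.
Qed.

(** Converse of Gaskin's theorem. In [circ_form_director] the factor conj(B) (c - a) is purely
    imaginary. If it is zero, [b] is singular; otherwise the polar of [c], which contains [b], has
    its normal orthogonal to [d - b]. *)
Lemma conj_form_next Q a b c d : a != c -> ~ polar0 Q b ->
  conj_form Q a b = 0 -> conj_form Q b c = 0 ->
  circ_form a b c d (dir_s Q) (dir_x Q) (dir_y Q) (dir_w Q) = 0 ->
  conj_form Q c d = 0.
Proof.
move=> ac Qb ab bc.
have h' : polar_x Q b * (c.x - a.x) + polar_y Q b * (c.y - a.y) = 0.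
  by rewrite polar_chord // conj_formC.
rewrite circ_form_director // h' oppr0 mul0r sub0r => /eqP; rewrite oppr_eq0 mulf_eq0 => /orP[/eqP h|/eqP h].
  have ac2 : (c.x - a.x) ^+ 2 + (c.y - a.y) ^+ 2 != 0.
    apply: contra ac; rewrite paddr_eq0 ?sqr_ge0 // !sqrf_eq0 !subr_eq0.
    case/andP=> /eqP hx /eqP hy; apply/eqP/rowP=> j.
    by case: (ord2P j) => ->.
  have Qx : polar_x Q b = 0.
    apply: (mulIf ac2); rewrite mul0r.
    transitivity ((polar_x Q b * (c.x - a.x) + polar_y Q b * (c.y - a.y)) * (c.x - a.x)
      + (polar_x Q b * (c.y - a.y) - polar_y Q b * (c.x - a.x)) * (c.y - a.y)); first by ring.
    by rewrite h h' !mul0r addr0.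
  have Qy : polar_y Q b = 0.
    apply: (mulIf ac2); rewrite mul0r.
    transitivity ((polar_x Q b * (c.x - a.x) + polar_y Q b * (c.y - a.y)) * (c.y - a.y)
      - (polar_x Q b * (c.y - a.y) - polar_y Q b * (c.x - a.x)) * (c.x - a.x)); first by ring.
    by rewrite h h' !mul0r subr0.
  case: Qb; split=> //.
  by move: bc; rewrite /conj_form Qx Qy !mul0r !add0r.
rewrite conj_formC in bc.
transitivity (conj_form Q c b
    + (polar_x Q c * (d.x - b.x) + polar_y Q c * (d.y - b.y))).
  by rewrite /conj_form; ring.
by rewrite h bc addr0.
Qed.

(** Otherwise the product of one polar normal with the conjugate of the other vanishes, so one
    normal is zero, and conjugacy makes its point singular. *)
Lemma director_neq0 Q p q : ~ polar0 Q p -> ~ polar0 Q q ->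
  conj_form Q p q = 0 ->
  ~ [/\ dir_s Q = 0, dir_x Q = 0, dir_y Q = 0 & dir_w Q = 0].
Proof.
move=> Qp Qq pq [s0 x0 y0 w0].
have polar0_xy a b : conj_form Q a b = 0 ->
    polar_x Q a ^+ 2 + polar_y Q a ^+ 2 = 0 -> polar0 Q a.
  move=> ab /eqP; rewrite paddr_eq0 ?sqr_ge0 // !sqrf_eq0.
  case/andP=> /eqP ax /eqP ay; split=> //.
  by move: ab; rewrite /conj_form ax ay !mul0r !add0r.
have re0 := chord_re_director Q p q; have im0 := chord_im_director Q p q.
rewrite s0 x0 y0 w0 pq mulr0 sub0r in re0; rewrite x0 y0 w0 in im0.
have /eqP : (polar_x Q p ^+ 2 + polar_y Q p ^+ 2) *
            (polar_x Q q ^+ 2 + polar_y Q q ^+ 2) = 0.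
  transitivity ((- (polar_x Q p * polar_x Q q + polar_y Q p * polar_y Q q)) ^+ 2
    + (polar_y Q p * polar_x Q q - polar_x Q p * polar_y Q q) ^+ 2); first by ring.
  by rewrite -re0 -im0 /chord_re /chord_im; ring.
rewrite mulf_eq0 => /orP[] /eqP h; first exact: Qp (polar0_xy _ _ pq h).
by apply: Qq; apply: polar0_xy h; rewrite conj_formC; exact: pq.
Qed.

(** * Values and independence of consecutive circle forms *)

Definition sqn p : R := p.x ^+ 2 + p.y ^+ 2.

Lemma circ_form_at2 a b c d : circ_form a b c d (sqn b) b.x b.y 1 = 0.
Proof. by rewrite /circ_form /chord_re /chord_im /sqn; ring. Qed.

Lemma circ_form_at3 a b c d : circ_form a b c d (sqn c) c.x c.y 1 = 0.
Proof. by rewrite /circ_form /chord_re /chord_im /sqn; ring. Qed.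

(** At z = a the factor conj(z - c) (c - a) is - |c - a|^2, and the rest is an area. *)
Lemma circ_form_at1 a b c d :
  circ_form a b c d (sqn a) a.x a.y 1 = - sqn (c - a) * det3 a b d.
Proof. by rewrite /circ_form /chord_re /chord_im /sqn /det3 !mxE; ring. Qed.

Lemma circ_form_at4 a b c d :
  circ_form a b c d (sqn d) d.x d.y 1 = - sqn (d - b) * det3 a c d.
Proof. by rewrite /circ_form /chord_re /chord_im /sqn /det3 !mxE; ring. Qed.


Lemma det3_eq p q r : p = q -> det3 p q r = 0.
Proof. by move=> ->; rewrite /det3; ring. Qed.

Lemma det3_rot p q r : det3 q r p = det3 p q r.
Proof. by rewrite /det3; ring. Qed.

Lemma sqn_eq0 p : (sqn p == 0) = (p == 0).
Proof.
apply/idP/eqP => [|->]; last by rewrite /sqn !mxE expr0n addr0.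
rewrite paddr_eq0 ?sqr_ge0 // !sqrf_eq0 => /andP[/eqP hx /eqP hy].
by apply/rowP=> j; case: (ord2P j) => ->; rewrite mxE.
Qed.

Definition join_form p q (x y w : R) :=
  (p.x * q.y - p.y * q.x) * w - (q.y - p.y) * x + (q.x - p.x) * y.

(** Splits the vector into the lifts (|p|^2 : p : 1), (|q|^2 : q : 1) and a remainder in the [s]
    direction. *)
Lemma circ_form_lin a b c d p q (s x y w u v : R) :
  x = u * p.x + v * q.x -> y = u * p.y + v * q.y -> w = u + v ->
  circ_form a b c d s x y w =
    (s - u * sqn p - v * sqn q) *
      ((c.y - a.y) * (d.x - b.x) - (c.x - a.x) * (d.y - b.y))
    + u * circ_form a b c d (sqn p) p.x p.y 1
    + v * circ_form a b c d (sqn q) q.x q.y 1.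
Proof. by move=> -> -> ->; rewrite /circ_form /chord_re /chord_im; ring. Qed.

(** Bounds the common kernel of three consecutive forms by dimension one. On the line [c d], the
    middle circle contains both points and kills the [s] remainder; each outer circle contains just
    one of them and kills the coefficient of the other. *)
Lemma circ_forms_indep a b c d e f (s x y w : R) :
  c != e -> b != d -> det3 c d f != 0 -> det3 a c d != 0 ->
  (d.y - b.y) * (e.x - c.x) != (d.x - b.x) * (e.y - c.y) ->
  circ_form a b c d s x y w = 0 -> circ_form b c d e s x y w = 0 ->
  circ_form c d e f s x y w = 0 -> join_form c d x y w = 0 ->
  [/\ s = 0, x = 0, y = 0 & w = 0].
Proof.
move=> ce bd cdf acd D h1 h2 h3 hj.
have cd : sqn (d - c) != 0.
  rewrite sqn_eq0 subr_eq0; apply: contra acd => /eqP E.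
  by rewrite -det3_rot E det3_eq.
set N := sqn (d - c) in cd.
pose v := ((x - w * c.x) * (d.x - c.x) + (y - w * c.y) * (d.y - c.y)) / N.
have hv : v * N = (x - w * c.x) * (d.x - c.x) + (y - w * c.y) * (d.y - c.y).
  by rewrite /v divfK.
clearbody v.
have NE : N = (d.x - c.x) ^+ 2 + (d.y - c.y) ^+ 2 by rewrite /N /sqn !mxE.
have hx : x = (w - v) * c.x + v * d.x.
  apply: (mulIf cd); apply/eqP; rewrite -subr_eq0; apply/eqP.
  transitivity ((x - w * c.x) * N - (d.x - c.x) * (v * N)); first by ring.
  rewrite hv NE; transitivity (- (d.y - c.y) * join_form c d x y w).
    by rewrite /join_form; ring.
  by rewrite hj mulr0.
have hy : y = (w - v) * c.y + v * d.y.
  apply: (mulIf cd); apply/eqP; rewrite -subr_eq0; apply/eqP.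
  transitivity ((y - w * c.y) * N - (d.y - c.y) * (v * N)); first by ring.
  rewrite hv NE; transitivity ((d.x - c.x) * join_form c d x y w).
    by rewrite /join_form; ring.
  by rewrite hj mulr0.
have hw : w = (w - v) + v by rewrite subrK.
move: h1 h2 h3; rewrite !(circ_form_lin _ _ _ _ s hx hy hw).
set s' := s - _ - _.
rewrite !circ_form_at2 !circ_form_at3 circ_form_at1 circ_form_at4 !mulr0 !addr0.
move=> h1 /eqP; rewrite mulf_eq0 [X in _ || X]subr_eq0 (negPf D) orbF => /eqP s0.
have [ec db] : sqn (e - c) != 0 /\ sqn (d - b) != 0.
  by rewrite !sqn_eq0 !subr_eq0 eq_sym ce eq_sym bd.
move: h1; rewrite s0 mul0r add0r => /eqP.
rewrite mulf_eq0 mulf_eq0 oppr_eq0 (negPf db) (negPf acd) !orbF => /eqP v0.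
rewrite mul0r add0r => /eqP.
rewrite mulf_eq0 mulf_eq0 oppr_eq0 (negPf ec) (negPf cdf) !orbF => /eqP wv0.
have w0 : w = 0 by rewrite hw wv0 v0 addr0.
split=> //; first by move: s0; rewrite /s' wv0 v0 !mul0r !subr0.
  by rewrite hx wv0 v0; ring.
by rewrite hy wv0 v0; ring.
Qed.

Lemma circ_form_scale a b c d (s x y w s' x' y' w' k l : R) :
  circ_form a b c d (k * s - l * s') (k * x - l * x') (k * y - l * y')
      (k * w - l * w') =
  k * circ_form a b c d s x y w - l * circ_form a b c d s' x' y' w'.
Proof. by rewrite /circ_form /chord_re /chord_im; ring. Qed.


(** * Propagation of conjugacy around the polygon *)

Lemma circ_forms_polygon n (z : nat -> 'rV[R]_2) (s x y w : R) :
  (5 <= n)%N -> (forall k, z (k + n)%N = z k) ->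
  (forall i j k, (i < j)%N -> (j < k)%N -> (k < i + n)%N ->
     det3 (z i) (z j) (z k) != 0) ->
  ((z 3).y - (z 1).y) * ((z 4).x - (z 2).x) !=
    ((z 3).x - (z 1).x) * ((z 4).y - (z 2).y) ->
  ~ [/\ s = 0, x = 0, y = 0 & w = 0] ->
  (forall k, (k <= n - 3)%N ->
     circ_form (z k) (z k.+1) (z k.+2) (z k.+3) s x y w = 0) ->
  forall k, circ_form (z k) (z k.+1) (z k.+2) (z k.+3) s x y w = 0.
Proof.
move=> n5 zn zdet D h0 hz.
have zneq i j : (i < j)%N -> (j.+1 < i + n)%N -> z i != z j.
  move=> ij jn; apply: contra (zdet i j j.+1 ij (ltnSn _) jn) => /eqP E.
  by rewrite det3_eq.
(* For [n = 5] the last pair closes the polygon, since [z 5 = z 0]. *)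
have [Q Q0 hQ] := conic_through_5pairs (fun i : 'I_5 => z i) (fun i : 'I_5 => z i.+1).
have Qz i : (i < 5)%N -> conj_form Q (z i) (z i.+1) = 0.
  by move=> lt_i; exact: (hQ (Ordinal lt_i)).
have [Q01 Q12 Q23 Q34 Q45] : [/\ conj_form Q (z 0) (z 1) = 0,
    conj_form Q (z 1) (z 2) = 0, conj_form Q (z 2) (z 3) = 0,
    conj_form Q (z 3) (z 4) = 0 & conj_form Q (z 4) (z 5) = 0].
  by split; apply: Qz.
(* A singular [z 1] is conjugate to every point; then [z 3], and after it [z 4], is conjugate to
   three non-collinear points, and [Q] is zero. *)
have Qz1 : ~ polar0 Q (z 1).
  move=> P1; have P3 : polar0 Q (z 3).
    apply: (@polar0_3points Q (z 3) (z 1) (z 2) (z 4)); first by apply: zdet => //; lia.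
    - by rewrite conj_formC conj_form_polar0.
    - by rewrite conj_formC.
    - by [].
  have P4 : polar0 Q (z 4).
    apply: (@polar0_3points Q (z 4) (z 1) (z 3) (z 5)); first by apply: zdet => //; lia.
    - by rewrite conj_formC conj_form_polar0.
    - by rewrite conj_formC.
    - by [].
  by apply: Q0; apply: (conic0_3points _ P1 P3 P4); apply: zdet => //; lia.
have Qz2 : ~ polar0 Q (z 2).
  move=> P2; have P4 : polar0 Q (z 4).
    apply: (@polar0_3points Q (z 4) (z 2) (z 3) (z 5)); first by apply: zdet => //; lia.
    - by rewrite conj_formC conj_form_polar0.
    - by rewrite conj_formC.
    - by [].
  apply: Qz1; apply: (@polar0_3points Q (z 1) (z 0) (z 2) (z 4)); first by apply: zdet => //; lia.
  - by rewrite conj_formC.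
  - by [].
  - by rewrite conj_formC conj_form_polar0.
have Qzi i : (4 <= i)%N -> (i < n)%N -> ~ polar0 Q (z i).
  move=> i4 iN Pi; apply: Qz1.
  apply: (@polar0_3points Q (z 1) (z 0) (z 2) (z i)); first by apply: zdet => //; lia.
  - by rewrite conj_formC.
  - by [].
  - by rewrite conj_formC conj_form_polar0.
pose S := dir_s Q; pose X := dir_x Q; pose Y := dir_y Q; pose W := dir_w Q.
have Cdir k : (k < 3)%N -> circ_form (z k) (z k.+1) (z k.+2) (z k.+3) S X Y W = 0.
  by move=> k3; apply: circ_form_director0; apply: Qz; lia.
have kerC s' x' y' w' :
    (forall k, (k < 3)%N -> circ_form (z k) (z k.+1) (z k.+2) (z k.+3) s' x' y' w' = 0) ->
    join_form (z 2) (z 3) x' y' w' = 0 -> [/\ s' = 0, x' = 0, y' = 0 & w' = 0].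
  move=> c3; apply: (@circ_forms_indep (z 0) (z 1) (z 2) (z 3) (z 4) (z 5)).
  - by apply: zneq; lia.
  - by apply: zneq; lia.
  - by apply: zdet; lia.
  - by apply: zdet; lia.
  - by [].
  - exact: (c3 0).
  - exact: (c3 1).
  - exact: (c3 2).
have r0 : join_form (z 2) (z 3) x y w != 0.
  apply/negP=> /eqP r0; apply: h0; apply: kerC => // k k3; apply: hz; lia.
set r := join_form _ _ _ _ _ in r0.
have rQ0 : join_form (z 2) (z 3) X Y W != 0.
  apply/negP=> /eqP rQ0; have [S0 X0 Y0 W0] := kerC _ _ _ _ Cdir rQ0.
  exact: (director_neq0 Qz1 Qz2 Q12).
set rQ := join_form _ _ _ _ _ in rQ0.
(* This combination is killed by the three forms and by [join_form], so the given vector is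
   proportional to the director circle. *)
have [Es Ex Ey Ew] : [/\ rQ * s - r * S = 0, rQ * x - r * X = 0,
    rQ * y - r * Y = 0 & rQ * w - r * W = 0].
  apply: kerC => [k k3|].
    by rewrite circ_form_scale Cdir // hz ?mulr0 ?subr0 //; lia.
  transitivity (rQ * r - r * rQ); last by rewrite mulrC subrr.
  by rewrite /rQ /r /join_form; ring.
have prop a b c d : rQ * circ_form a b c d s x y w = r * circ_form a b c d S X Y W.
  apply/eqP; rewrite -subr_eq0 -circ_form_scale Es Ex Ey Ew; apply/eqP.
  by rewrite /circ_form /chord_re /chord_im; ring.
(* Circle [k] yields the pair of indices [k + 2], [k + 3]; the bound [k <= n - 3] just reaches the
   closing pair [n - 1], [n]. *)
have Qlow i : (i < n)%N -> conj_form Q (z i) (z i.+1) = 0.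
  elim/ltn_ind: i => i IH iN; case: (ltnP i 5) => [/Qz //|i5].
  case: i => [|[|i]] // in IH iN i5 *.
  apply: (@conj_form_next Q (z i) (z i.+1)).
  - by apply: zneq; lia.
  - by apply: Qzi; lia.
  - by apply: IH; lia.
  - by apply: IH; lia.
  - apply/eqP; have := prop (z i) (z i.+1) (z i.+2) (z i.+3).
    rewrite hz ?mulr0; last by lia.
    by move/esym/eqP; rewrite mulf_eq0 (negPf r0).
have Qall i : conj_form Q (z i) (z i.+1) = 0.
  elim/ltn_ind: i => i IH; case: (ltnP i n) => [/Qlow //|ni].
  by rewrite -(subnK ni) -addSn !zn; apply: IH; lia.
move=> k; apply/eqP; have := prop (z k) (z k.+1) (z k.+2) (z k.+3).
rewrite (circ_form_director0 (Qall k) (Qall k.+1) (Qall k.+2)) mulr0.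
by move/eqP; rewrite mulf_eq0 (negPf rQ0).
Qed.

End Core.

(** * Lines, circles and radical axes in coordinates *)

Section Geometry.
Variable R : realType.
Implicit Types (a b c d p q r : 'rV[R]_2) (C : circle R).

Lemma plane_eq p q : p.x = q.x -> p.y = q.y -> p = q.
Proof. by move=> hx hy; apply/rowP=> j; case: (ord2P j) => ->. Qed.

Lemma line_through_l p q : line_through p q p.
Proof. by exists 0; rewrite scale0r addr0. Qed.

Lemma line_through_r p q : line_through p q q.
Proof. by exists 1; rewrite scale1r addrC subrK. Qed.

Lemma dir_neq0 p q : p != q -> (q.x - p.x) ^+ 2 + (q.y - p.y) ^+ 2 != 0.
Proof.
move=> pq; have := sqn_eq0 (q - p).
by rewrite /sqn !mxE subr_eq0 [q == p]eq_sym => ->.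
Qed.

Lemma line_throughP p q r : p != q -> line_through p q r <-> det3 p q r = 0.
Proof.
move=> pq; have N := dir_neq0 pq; split=> [[t ->]|].
  by rewrite /det3 !mxE; ring.
rewrite /det3 => h.
pose t := ((r.x - p.x) * (q.x - p.x) + (r.y - p.y) * (q.y - p.y)) /
  ((q.x - p.x) ^+ 2 + (q.y - p.y) ^+ 2).
have ht : t * ((q.x - p.x) ^+ 2 + (q.y - p.y) ^+ 2) =
  (r.x - p.x) * (q.x - p.x) + (r.y - p.y) * (q.y - p.y) by rewrite /t divfK.
exists t; apply: plane_eq; rewrite !mxE; apply: (mulIf N); apply/eqP;
  rewrite -subr_eq0; apply/eqP; move: ht; set N' := _ ^+ 2 + _ => ht.
  transitivity ((r.x - p.x) * N' - (t * N') * (q.x - p.x)); first by ring.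
  rewrite ht /N'.
  transitivity (- (q.y - p.y) * ((q.x - p.x) * (r.y - p.y) - (q.y - p.y) * (r.x - p.x))).
    by ring.
  by rewrite h mulr0.
transitivity ((r.y - p.y) * N' - (t * N') * (q.y - p.y)); first by ring.
rewrite ht /N'.
transitivity ((q.x - p.x) * ((q.x - p.x) * (r.y - p.y) - (q.y - p.y) * (r.x - p.x))).
  by ring.
by rewrite h mulr0.
Qed.

Lemma ex_neq p : exists q, p != q.
Proof.
exists (p + const_mx 1); apply/eqP=> /rowP/(_ 0); rewrite !mxE => /eqP.
by rewrite -subr_eq0 opprD addrA subrr sub0r oppr_eq0 oner_eq0.
Qed.

Lemma noncollinear_det3 p q r : ~ collinear p q r -> det3 p q r != 0.
Proof.
move=> npqr; apply/eqP=> D; apply: npqr.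
have [pq|pq] := eqVneq p q; last first.
  exists (line_through p q); split; first by exists p, q.
  - exact: line_through_l.
  - exact: line_through_r.
  - exact/line_throughP.
rewrite -pq; have [pr|pr] := eqVneq p r; last first.
  exists (line_through p r); split; first by exists p, r.
  - exact: line_through_l.
  - exact: line_through_l.
  - exact: line_through_r.
rewrite -pr; have [t pt] := ex_neq p.
exists (line_through p t); split; first by exists p, t.
all: exact: line_through_l.
Qed.

Definition power_form C (s x y w : R) : R :=
  s - 2 * (center C).x * x - 2 * (center C).y * y
    + (sqn (center C) - radius C ^+ 2) * w.

Lemma sqdistE p q : sqdist p q = (p.x - q.x) ^+ 2 + (p.y - q.y) ^+ 2.
Proof.
rewrite /sqdist big_ord_recl big_ord1.
by have -> : lift ord0 ord0 = 1 :> 'I_2 by apply: val_inj.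
Qed.

Lemma powerE C p : power C p = power_form C (sqn p) p.x p.y 1.
Proof. by rewrite /power sqdistE /power_form /sqn; ring. Qed.

Lemma on_circleP C p : on_circle C p <-> power C p = 0.
Proof.
rewrite /on_circle /power; split=> [->|/eqP]; first by rewrite subrr.
by rewrite subr_eq0 => /eqP.
Qed.

Lemma det3_neq p q r : det3 p q r != 0 -> [/\ p != q, q != r & p != r].
Proof.
move=> D; split; apply: contra D => /eqP E.
- by rewrite det3_eq.
- by rewrite -det3_rot det3_eq.
- by rewrite -2!det3_rot det3_eq.
Qed.

(** The coefficient of [s] in [circ_form]. *)
Definition lines_cross a b c d : R :=
  (c.y - a.y) * (d.x - b.x) - (c.x - a.x) * (d.y - b.y).

(** For parallel directions, [p + (c - a)] would be a second common point. *)
Lemma unique_meet_cross a b c d p : a != c -> b != d ->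
  line_through a c `&` line_through b d = [set p] -> lines_cross a b c d != 0.
Proof.
move=> ac bd E; apply/eqP=> D.
have [hac hbd] : (line_through a c `&` line_through b d) p by rewrite E.
have : (line_through a c `&` line_through b d) (p + (c - a)).
  move/(line_throughP _ ac) : hac => hac; move/(line_throughP _ bd): hbd => hbd.
  split; [apply/line_throughP => //|apply/line_throughP => //].
    by rewrite -hac /det3 !mxE; ring.
  transitivity (det3 b d p + lines_cross a b c d).
    by rewrite /det3 /lines_cross !mxE; ring.
  by rewrite D hbd addr0.
rewrite E => /= /eqP; rewrite -subr_eq0 addrAC subrr add0r subr_eq0 eq_sym.
by rewrite (negPf ac).
Qed.

(** The [s] coefficients agree, so the difference of the two sides is an affine form; it vanishes at
    the non-collinear points [b], [c], [p]. *)
Lemma circ_form_power a b c d p C (s x y w : R) :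
  det3 a b c != 0 -> det3 b c d != 0 -> lines_cross a b c d != 0 ->
  line_through a c p -> line_through b d p ->
  on_circle C b -> on_circle C p -> on_circle C c ->
  circ_form a b c d s x y w = lines_cross a b c d * power_form C s x y w.
Proof.
move=> abc bcd D [t pt] [u pu] /on_circleP Cb /on_circleP Cp /on_circleP Cc.
rewrite powerE in Cb; rewrite powerE in Cp; rewrite powerE in Cc.
have ptx : p.x = a.x + t * (c.x - a.x) by rewrite pt !mxE.
have pty : p.y = a.y + t * (c.y - a.y) by rewrite pt !mxE.
have pux : p.x = b.x + u * (d.x - b.x) by rewrite pu !mxE.
have puy : p.y = b.y + u * (d.y - b.y) by rewrite pu !mxE.
have pcx : p.x - c.x = (t - 1) * (c.x - a.x) by rewrite ptx; ring.
have pcy : p.y - c.y = (t - 1) * (c.y - a.y) by rewrite pty; ring.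
have pbx : p.x - b.x = u * (d.x - b.x) by rewrite pux; ring.
have pby : p.y - b.y = u * (d.y - b.y) by rewrite puy; ring.
have u0 : u != 0.
  apply: contra abc => /eqP u0; apply/eqP.
  rewrite /det3; have -> : b.x = a.x + t * (c.x - a.x) by rewrite -ptx pux u0; ring.
  by have -> : b.y = a.y + t * (c.y - a.y) by [rewrite -pty puy u0; ring]; ring.
have t1 : t - 1 != 0.
  apply: contra bcd => /eqP t1; apply/eqP.
  have cx : c.x = b.x + u * (d.x - b.x).
    by rewrite -pux -[RHS](subrK c.x) pcx t1 mul0r add0r.
  have cy : c.y = b.y + u * (d.y - b.y).
    by rewrite -puy -[RHS](subrK c.y) pcy t1 mul0r add0r.
  by rewrite /det3 cx cy; ring.
have bcp : det3 b c p != 0.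
  have -> : det3 b c p = (t - 1) * u * lines_cross a b c d.
    transitivity ((p.x - b.x) * (p.y - c.y) - (p.y - b.y) * (p.x - c.x)).
      by rewrite /det3; ring.
    by rewrite pcx pcy pbx pby /lines_cross; ring.
  by rewrite !mulf_neq0.
(* Here [p - c] is a multiple of [c - a] and [p - b] one of [d - b], so the complex product defining
   the circle is real. *)
have Fp : circ_form a b c d (sqn p) p.x p.y 1 = 0.
  transitivity
    (((p.x - b.x) * (p.x - c.x) + (p.y - b.y) * (p.y - c.y)) * lines_cross a b c d
     + ((p.y - b.y) * (p.x - c.x) - (p.x - b.x) * (p.y - c.y)) *
       ((c.x - a.x) * (d.x - b.x) + (c.y - a.y) * (d.y - b.y))).
    by rewrite /circ_form /chord_re /chord_im /sqn /lines_cross; ring.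
  by rewrite pcx pcy pbx pby /lines_cross; ring.
set D0 := lines_cross a b c d.
pose g (s x y w : R) := circ_form a b c d s x y w - D0 * power_form C s x y w.
have gE q : g 0 1 0 0 * q.x + g 0 0 1 0 * q.y + g 0 0 0 1 = g (sqn q) q.x q.y 1.
  rewrite /g /circ_form /chord_re /chord_im /power_form /D0 /lines_cross; ring.
have [g1 g2 g3] : [/\ g 0 1 0 0 = 0, g 0 0 1 0 = 0 & g 0 0 0 1 = 0].
  apply: (affine_form_eq0 bcp); rewrite gE /g.
  - by rewrite circ_form_at2 Cb mulr0 subr0.
  - by rewrite circ_form_at3 Cc mulr0 subr0.
  - by rewrite Fp Cp mulr0 subr0.
apply/eqP; rewrite -subr_eq0; apply/eqP.
transitivity (g 0 1 0 0 * x + g 0 0 1 0 * y + g 0 0 0 1 * w).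
  rewrite /g /circ_form /chord_re /chord_im /power_form /D0 /lines_cross; ring.
by rewrite g1 g2 g3; ring.
Qed.

(** The [s] coefficient is 1 for every circle and cancels, so [s] may be set to 0. *)
Lemma radical_axisP C C' p :
  radical_axis C C' p <-> power_form C 0 p.x p.y 1 = power_form C' 0 p.x p.y 1.
Proof.
have E C0 : power C0 p = sqn p + power_form C0 0 p.x p.y 1.
  by rewrite powerE /power_form; ring.
by rewrite /radical_axis /= !E; split=> [/addrI|->].
Qed.

Lemma radical_axis_dir C C' p q : radical_axis C C' p ->
  radical_axis C C' q <->
  ((center C).x - (center C').x) * (q.x - p.x)
    + ((center C).y - (center C').y) * (q.y - p.y) = 0.
Proof.
move=> /radical_axisP hp; rewrite radical_axisP.
have E : (power_form C 0 q.x q.y 1 - power_form C' 0 q.x q.y 1) -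
  (power_form C 0 p.x p.y 1 - power_form C' 0 p.x p.y 1) =
  (- 2) * (((center C).x - (center C').x) * (q.x - p.x)
    + ((center C).y - (center C').y) * (q.y - p.y)).
  by rewrite /power_form; ring.
rewrite hp subrr subr0 in E; split=> h.
  move: E; rewrite h subrr => /esym/eqP.
  by rewrite mulf_eq0 oppr_eq0 pnatr_eq0 => /eqP.
by apply/eqP; rewrite -subr_eq0 E h mulr0.
Qed.

(** Powers for concentric circles differ by a constant, which a common point makes zero. *)
Lemma center_neq C C' p q : power C p = 0 -> power C' p = 0 ->
  power C q = 0 -> power C' q != 0 -> center C != center C'.
Proof.
move=> Cp Cp' Cq; apply: contra => /eqP E; apply/eqP.
have : power C q - power C p = power C' q - power C' p.
  by rewrite !powerE /power_form E; ring.
by rewrite Cp Cp' Cq !subr0.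
Qed.

Lemma radical_axis_line C C' p : center C != center C' ->
  radical_axis C C' p ->
  exists2 q, p != q & radical_axis C C' = line_through p q.
Proof.
move=> cc hp; have N := dir_neq0 cc.
(* The difference of the centres, turned by a right angle. *)
pose q := p + \row_j (if j == 0 then (center C).y - (center C').y
                      else (center C').x - (center C).x).
have qx : q.x = p.x + ((center C).y - (center C').y) by rewrite !mxE.
have qy : q.y = p.y + ((center C').x - (center C).x) by rewrite !mxE.
have pq : p != q.
  apply: contra N => /eqP E; have Ex := qx; have Ey := qy.
  rewrite -E in Ex Ey.
  have -> : (center C').x - (center C).x = 0 by apply: (addrI p.y); rewrite -Ey addr0.
  have /eqP : (center C).y - (center C').y = 0 by apply: (addrI p.x); rewrite -Ex addr0.
  by rewrite subr_eq0 => /eqP ->; rewrite subrr expr0n addr0.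
exists q => //; apply/seteqP; split=> r.
  move/(radical_axis_dir _ hp) => h; apply/line_throughP => //.
  by rewrite -h /det3 qx qy; ring.
move/(line_throughP _ pq) => h; apply/(radical_axis_dir _ hp).
by rewrite -h /det3 qx qy; ring.
Qed.


Lemma radical_axis_is_line C C' p : center C != center C' ->
  radical_axis C C' p -> is_line (radical_axis C C').
Proof. by move=> cc /(radical_axis_line cc)[q pq ->]; exists p, q. Qed.

(** * Pencils as projective points *)

(** Both kinds of pencil become one vector: (O : 1) for a centre [O], (u : 0) for a direction
    [u]. *)
Lemma pencil_power_form (P : set (set 'rV[R]_2)) : is_pencil P ->
  exists x y w, ~ [/\ x = 0, y = 0 & w = 0] /\
  forall C C' p, center C != center C' -> radical_axis C C' p ->
    P (radical_axis C C') <-> power_form C 0 x y w = power_form C' 0 x y w.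
Proof.
case=> [[O ->]|[M [[X [Y [XY ->]]] ->]]].
  exists O.x, O.y, 1; split=> [[_ _ /eqP]|C C' p cc hp]; first by rewrite oner_eq0.
  rewrite -radical_axisP; split=> [[]//|hO]; split=> //.
  exact: radical_axis_is_line cc hp.
pose u := Y - X.
have ux : u.x = Y.x - X.x by rewrite !mxE.
have uy : u.y = Y.y - X.y by rewrite !mxE.
exists u.x, u.y, 0; split=> [[u1 u2 _]|C C' p cc hp].
  have := dir_neq0 XY.
  by rewrite -ux -uy u1 u2 expr0n addr0 eqxx.
set k := (center C).x - (center C').x.
set l := (center C).y - (center C').y.
have -> : power_form C 0 u.x u.y 0 = power_form C' 0 u.x u.y 0 <->
    k * u.x + l * u.y = 0.
  have E : power_form C 0 u.x u.y 0 - power_form C' 0 u.x u.y 0 =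
      (- 2) * (k * u.x + l * u.y) by rewrite /power_form /k /l; ring.
  split=> h; last by apply/eqP; rewrite -subr_eq0 E h mulr0.
  move: E; rewrite h subrr => /esym/eqP.
  by rewrite mulf_eq0 oppr_eq0 pnatr_eq0 => /eqP.
split=> [[_ [E|E]]|h].
- have hX : radical_axis C C' X by rewrite E; exact: line_through_l.
  have hY : radical_axis C C' Y by rewrite E; exact: line_through_r.
  by move/(radical_axis_dir _ hX): hY; rewrite -ux -uy.
- apply/eqP; apply: contraT => h.
  (* Solves for the point where the line meets an axis not parallel to it. *)
  pose t := (k * (p.x - X.x) + l * (p.y - X.y)) / (k * u.x + l * u.y).
  have : (radical_axis C C' `&` line_through X Y) (X + t *: u).
    split; last by exists t.
    apply/(radical_axis_dir _ hp); rewrite -/k -/l.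
    rewrite [(X + _).x]mxE [(t *: u).x]mxE [(X + _).y]mxE [(t *: u).y]mxE.
    transitivity (t * (k * u.x + l * u.y)
      - (k * (p.x - X.x) + l * (p.y - X.y))); first by ring.
    by rewrite /t divfK // subrr.
  by rewrite E.
- split; first exact: radical_axis_is_line cc hp.
  have [[q [rq mq]]|nq] := pselect (exists q, (radical_axis C C' `&` line_through X Y) q).
    have D r : det3 X Y r = u.x * (r.y - q.y) - u.y * (r.x - q.x).
      have /(line_throughP _ XY) mq' := mq.
      transitivity (det3 X Y r - det3 X Y q); first by rewrite mq' subr0.
      by rewrite /det3 ux uy; ring.
    left; apply/seteqP; split=> r.
      move/(radical_axis_dir _ rq); rewrite -/k -/l => hr.
      apply/line_throughP => //; rewrite D; apply: (mulfI (dir_neq0 cc)).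
      transitivity ((k * u.x + l * u.y) * (k * (r.y - q.y) - l * (r.x - q.x))
        - (k * u.y - l * u.x) * (k * (r.x - q.x) + l * (r.y - q.y))).
        by rewrite /k /l; ring.
      by rewrite h hr mul0r !mulr0 subr0.
    move/(line_throughP _ XY); rewrite D => hr; apply/(radical_axis_dir _ rq).
    apply: (mulfI (dir_neq0 XY)); rewrite -/k -/l -ux -uy.
    transitivity ((k * u.x + l * u.y) * (u.x * (r.x - q.x) + u.y * (r.y - q.y))
      + (u.x * l - u.y * k) * (u.x * (r.y - q.y) - u.y * (r.x - q.x))); first by ring.
    by rewrite h hr mul0r !mulr0 addr0.
  right; apply/seteqP; split=> // q hq; case: nq; by exists q.
Qed.

End Geometry.

(** * The cyclic polygon and its axes *)

Theorem theorem2 (R : realType) (n : nat)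
    (A B : 'I_n -> plane R) (c : 'I_n -> circle R) :
  (5 <= n)%N ->
  (forall i j k : 'I_n, i != j -> j != k -> i != k ->
     ~ collinear (A i) (A j) (A k)) ->
  (forall i : 'I_n, short_diagonal A i `&` short_diagonal A (ordS i) = [set B i]) ->
  (forall i : 'I_n,
     [/\ on_circle (c i) (A i), on_circle (c i) (B i)
       & on_circle (c i) (A (ordS i))]) ->
  forall P : set (set (plane R)), is_pencil P ->
    (forall i : 'I_n, (i < n - 3)%N -> P (consecutive_radical_axis c i)) ->
    forall i : 'I_n, P (consecutive_radical_axis c i).
Proof.
move=> n5 ncol hB hc P hP hg.
have n0 : (0 < n)%N by lia.
pose idx m : 'I_n := Ordinal (ltn_pmod m n0).
have idxS m : ordS (idx m) = idx m.+1.
  by apply: val_inj; rewrite /= -addn1 modnDml addn1.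
have idxP m : ord_pred (idx m.+1) = idx m by rewrite -idxS ordSK.
have idxn m : idx (m + n)%N = idx m by apply: val_inj; rewrite /= modnDr.
have idx_neq i j : (i < j)%N -> (j < i + n)%N -> idx i != idx j.
  move=> ij jn; apply/eqP=> /(congr1 val) /= /esym/eqP.
  rewrite eqn_mod_dvd; last by lia.
  by move/dvdn_leq; lia.
have idxE (i : 'I_n) : idx i = i by apply: val_inj; rewrite /= modn_small.
(* The shift makes z k, z k.+1, z k.+2, z k.+3 the four points involved in the
   circle e k, and e 0, ..., e (n - 3) the circles of the first n - 3 axes. *)
pose z k := A (idx (k + (n - 2))%N).
pose b k := B (idx (k.+1 + (n - 2))%N).
pose e k := c (idx (k.+1 + (n - 2))%N).
have zdet i j k : (i < j)%N -> (j < k)%N -> (k < i + n)%N ->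
    det3 (z i) (z j) (z k) != 0.
  by move=> ij jk kn; apply/noncollinear_det3/ncol; apply: idx_neq; lia.
have zl k : short_diagonal A (idx (k.+1 + (n - 2))%N) = line_through (z k) (z k.+2).
  by rewrite /short_diagonal addSn idxP idxS.
have zmeet k : line_through (z k) (z k.+2) `&` line_through (z k.+1) (z k.+3) = [set b k].
  by rewrite -zl -zl -hB idxS.
have zneq2 k : z k != z k.+2.
  by have [] := det3_neq (zdet k k.+1 k.+2 ltac:(lia) ltac:(lia) ltac:(lia)).
have cross k : lines_cross (z k) (z k.+1) (z k.+2) (z k.+3) != 0.
  exact: unique_meet_cross (zmeet k).
have [ze1 ze2] : (forall k, on_circle (e k) (z k.+1)) /\ (forall k, on_circle (e k) (z k.+2)).
  split=> k; first by have [] := hc (idx (k.+1 + (n - 2))%N).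
  by have [_ _] := hc (idx (k.+1 + (n - 2))%N); rewrite idxS.
have zcirc k s x y w : circ_form (z k) (z k.+1) (z k.+2) (z k.+3) s x y w =
    lines_cross (z k) (z k.+1) (z k.+2) (z k.+3) * power_form (e k) s x y w.
  have [h1 h2] : (line_through (z k) (z k.+2) `&` line_through (z k.+1) (z k.+3)) (b k).
    by rewrite zmeet.
  apply: (circ_form_power _ _ _ _ (p := b k)) => //; try by apply: zdet; lia.
  by have [] := hc (idx (k.+1 + (n - 2))%N).
have zon k : radical_axis (e k) (e k.+1) (z k.+2).
  have /on_circleP h1 := ze2 k; have /on_circleP h2 := ze1 k.+1.
  by rewrite /radical_axis /= h1 h2.
have ecc k : center (e k) != center (e k.+1).
  (* Both circles contain [z k.+2], but [z k.+1] lies on [e k] only, by [circ_form_at1]. *)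
  apply: (center_neq (p := z k.+2) (q := z k.+1)); try exact/on_circleP.
  have := circ_form_at1 (z k.+1) (z k.+2) (z k.+3) (z k.+4).
  rewrite zcirc -powerE => h; apply/eqP=> h0; move: h; rewrite h0 mulr0 => /esym/eqP.
  rewrite mulf_eq0 oppr_eq0 sqn_eq0 subr_eq0 eq_sym (negPf (zneq2 _)) /=.
  by apply/negP; apply: zdet; lia.
have axisE k : consecutive_radical_axis c (idx (k.+2 + (n - 2))%N) =
    radical_axis (e k) (e k.+1).
  by rewrite /consecutive_radical_axis !addSn idxP.
have [x [y [w [h0 hP']]]] := pencil_power_form hP.
have PE k : P (radical_axis (e k) (e k.+1)) <->
    power_form (e k) 0 x y w = power_form (e k.+1) 0 x y w.
  exact: hP' (ecc k) (zon k).
(* Chosen so that the form of [e 0] vanishes; the first n - 3 axes then carry the zero on to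
   [e (n - 3)]. *)
pose s := - power_form (e 0) 0 x y w.
have sE C : power_form C s x y w = s + power_form C 0 x y w.
  by rewrite /power_form; ring.
(* The axis between [e k] and [e k.+1] is thus the one with index [k]. *)
have shift k : idx (k.+2 + (n - 2))%N = idx k.
  by rewrite -[in RHS](idxn k); congr idx; lia.
have elow k : (k <= n - 3)%N -> power_form (e k) s x y w = 0.
  elim: k => [_|k IH kn]; first by rewrite sE addNr.
  rewrite -IH ?(ltnW kn) // !sE; congr (_ + _); apply/esym/PE.
  by rewrite -axisE shift; apply: hg; rewrite /= modn_small //; lia.
have eall k : power_form (e k) s x y w = 0.
  apply: (mulfI (cross k)); rewrite mulr0 -zcirc; move: k.
  apply: (circ_forms_polygon n5) => //.
  - by move=> k; rewrite /z addnAC idxn.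
  - by have := cross 1; rewrite /lines_cross subr_eq0.
  - by case=> _ x0 y0 w0; apply: h0.
  - by move=> k kn; rewrite zcirc elow ?mulr0.
move=> i; rewrite -(idxE i) -shift axisE; apply/PE.
by apply: (addrI s); rewrite -!sE !eall.
Qed.
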